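(* Let $a$ be a real number with $a^{2}<1$, and write $a=\cos t$ with $t\in(0,\pi)$. Then $$\int_{0}^{1}\frac{\log x\,dx}{x^{2}-2ax+1}=-\frac{1}{\sin t}\sum_{k=1}^{\infty}\frac{\sin(kt)}{k^{2}}=-\frac{\operatorname{Cl}_{2}(t)}{\sin t}.$$
   Context: $\operatorname{Cl}_{2}$ denotes the Clausen function, defined for real $x$ by $\operatorname{Cl}_{2}(x)=\sum_{k=1}^{\infty}\frac{\sin(kx)}{k^{2}}$. *)

(* Defs.v *)
From Stdlib Require Import Reals Lra Lia.
From Coquelicot Require Import Coquelicot.
Open Scope R_scope.

(* [Series] sums from index 0, so its index [n] is k - 1. *)
Definition Cl2 (x : R) : R :=
  Series (fun n : nat => sin (INR (S n) * x) / INR (S n) ^ 2).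

(* [Series] also has a value on divergent series; this one converges for
   every real [x]. *)
Lemma ex_series_Cl2 (x : R) :
  ex_series (fun n : nat => sin (INR (S n) * x) / INR (S n) ^ 2).
Proof.
apply (ex_series_le (K := R_AbsRing) (V := R_CompleteNormedModule) _
  (fun n => 2 * (/ INR (S n) - / INR (S (S n))))).
- intros n.
  change (norm (sin (INR (S n) * x) / INR (S n) ^ 2))
    with (Rabs (sin (INR (S n) * x) / INR (S n) ^ 2)).
  rewrite (S_INR (S n)).
  assert (H : 1 <= INR (S n)) by (rewrite S_INR; pose proof (pos_INR n); lra).
  set (m := INR (S n)) in *.
  unfold Rdiv; rewrite Rabs_mult.
  rewrite (Rabs_right (/ m ^ 2))
    by (apply Rle_ge, Rlt_le, Rinv_0_lt_compat, pow_lt; lra).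
  apply Rle_trans with (1 * / m ^ 2).
  + apply Rmult_le_compat_r.
    * apply Rlt_le, Rinv_0_lt_compat, pow_lt; lra.
    * apply Rabs_le; pose proof (SIN_bound (m * x)); lra.
  + apply Rminus_le.
    replace (1 * / m ^ 2 - 2 * (/ m - / (m + 1)))
      with (- ((m - 1) * / (m ^ 2 * (m + 1)))) by (field; lra).
    assert (0 < / (m ^ 2 * (m + 1)))
      by (apply Rinv_0_lt_compat, Rmult_lt_0_compat; [apply pow_lt|]; lra).
    nra.
- exists 2.
  change (is_lim_seq (sum_n (fun n => 2 * (/ INR (S n) - / INR (S (S n))))) 2).
  apply is_lim_seq_ext with (fun n => 2 - 2 * / INR (S (S n))).
  + intros n; induction n as [|n IH].
    * rewrite sum_O; simpl; field.
    * rewrite sum_Sn, <- IH.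
      change (plus ?u ?v) with (u + v).
      ring.
  + replace (Finite 2) with (Finite (2 - 2 * 0)) by (f_equal; ring).
    apply is_lim_seq_minus'; [apply is_lim_seq_const|].
    apply (is_lim_seq_scal_l _ 2 0).
    apply (is_lim_seq_incr_1 (fun n => / INR (S n))).
    apply (is_lim_seq_incr_1 (fun n => / INR n)).
    apply (is_lim_seq_inv _ p_infty); [apply is_lim_seq_INR | discriminate].
Qed.

(* Main.v *)
Require Import Defs.
From Stdlib Require Import Reals Lra Lia.
From Coquelicot Require Import Coquelicot.
Open Scope R_scope.

(** The reason is the expansion
    sin t / (x^2 - 2 x cos t + 1) = sum over k >= 1 of sin (k t) x^(k-1),
    integrated term by term against ln x, where the integral of
    x^(k-1) ln x over (0, 1] is - 1 / k^2.

    Exchange of sum and integral needs no convergence theorem, because the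
    partial sums have an exact remainder ([sine_partial_sum]) and the
    denominator is at least (sin t)^2: the remainder after N terms is at most
    2 x^N / (sin t)^2, and its integral against |ln x| is O(1 / N^2), uniformly
    in the lower bound e of the integral.  The boundary terms at e left by the
    first N integrals are at most N e (1 - ln e).  Together these give
    [integral_error], from which the limit follows by choosing first N, then e. *)

(** * The sine expansion and its remainder *)

Lemma quadratic_ge_sin_sq (t x : R) :
  sin t ^ 2 <= x ^ 2 - 2 * cos t * x + 1.
Proof.
pose proof (sin2_cos2 t) as H; unfold Rsqr in H.
pose proof (pow2_ge_0 (x - cos t)).
nra.
Qed.

(** The sum telescopes after multiplication by the quadratic, since
    sin ((n+2) t) + sin (n t) = 2 cos t sin ((n+1) t). *)
Lemma sine_partial_sum (t x : R) (N : nat) :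
  (x ^ 2 - 2 * cos t * x + 1) * sum_n (fun n => sin (INR (S n) * t) * x ^ n) N
  = sin t - x ^ S N * (sin (INR (S (S N)) * t) - x * sin (INR (S N) * t)).
Proof.
induction N as [|N IH].
- rewrite sum_O.
  replace (INR 2 * t) with (2 * t) by (simpl; ring).
  replace (INR 1 * t) with t by (simpl; ring).
  rewrite sin_2a; simpl; ring.
- rewrite sum_Sn; change (plus ?u ?v) with (u + v).
  rewrite Rmult_plus_distr_l, IH.
  rewrite (S_INR (S (S N))).
  rewrite (S_INR (S N)).
  set (m := INR (S N)).
  replace (m * t) with ((m + 1) * t - t) by ring.
  replace ((m + 1 + 1) * t) with ((m + 1) * t + t) by ring.
  rewrite sin_minus, sin_plus.
  simpl; ring.
Qed.

Lemma sine_remainder_bound (t x : R) (N : nat) :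
  0 < sin t -> 0 <= x <= 1 ->
  Rabs (sin t / (x ^ 2 - 2 * cos t * x + 1)
        - sum_n (fun n => sin (INR (S n) * t) * x ^ n) N)
  <= 2 / sin t ^ 2 * x ^ S N.
Proof.
intros Hs Hx.
pose proof (quadratic_ge_sin_sq t x) as HD.
assert (Hs2 : 0 < sin t ^ 2) by (apply pow_lt; exact Hs).
pose proof (sine_partial_sum t x N) as E.
set (D := x ^ 2 - 2 * cos t * x + 1) in *.
set (Sg := sum_n _ N) in *.
set (r := sin (INR (S (S N)) * t) - x * sin (INR (S N) * t)) in *.
replace (sin t / D - Sg) with (x ^ S N * r * / D)
  by (replace (sin t) with (D * Sg + x ^ S N * r) by lra; field; lra).
assert (Hp : 0 <= x ^ S N) by (apply pow_le; lra).
assert (Hr : Rabs r <= 2).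
{ apply Rabs_le; unfold r.
  pose proof (SIN_bound (INR (S (S N)) * t)).
  pose proof (SIN_bound (INR (S N) * t)).
  nra. }
rewrite !Rabs_mult, (Rabs_pos_eq (x ^ S N)) by exact Hp.
assert (HiD : 0 < / D) by (apply Rinv_0_lt_compat; lra).
rewrite (Rabs_pos_eq (/ D)) by lra.
assert (HDs : / D <= / sin t ^ 2) by (apply Rinv_le_contravar; lra).
replace (2 / sin t ^ 2 * x ^ S N) with (x ^ S N * 2 * / sin t ^ 2)
  by (unfold Rdiv; ring).
apply Rmult_le_compat; try lra.
- apply Rmult_le_pos; [exact Hp | apply Rabs_pos].
- apply Rmult_le_compat_l; assumption.
Qed.

(** * Integrals of powers against the logarithm *)

Definition pow_ln_primitive (n : nat) (x : R) : R :=
  x ^ S n * (ln x / INR (S n) - 1 / INR (S n) ^ 2).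

Lemma is_RInt_pow_ln (n : nat) (e : R) :
  0 < e <= 1 ->
  is_RInt (fun x => x ^ n * ln x) e 1
    (- (1 / INR (S n) ^ 2) - pow_ln_primitive n e).
Proof.
intros He.
assert (Hn : INR (S n) <> 0) by (apply not_0_INR; lia).
replace (- (1 / INR (S n) ^ 2)) with (pow_ln_primitive n 1)
  by (unfold pow_ln_primitive; rewrite ln_1, pow1; field; exact Hn).
apply (is_RInt_derive (pow_ln_primitive n)).
- intros x Hx; rewrite Rmin_left, Rmax_right in Hx by lra.
  unfold pow_ln_primitive; auto_derive; [lra|].
  change (match n with 0%nat => 1 | S _ => INR n + 1 end) with (INR (S n)).
  change (Init.Nat.pred (S n)) with n.
  field; split; [exact Hn | lra].
- intros x Hx; rewrite Rmin_left, Rmax_right in Hx by lra.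
  apply (ex_derive_continuous (fun x => x ^ n * ln x)).
  auto_derive; lra.
Qed.

Lemma pow_ln_primitive_bound (n : nat) (e : R) :
  0 < e <= 1 -> - (e * (1 - ln e)) <= pow_ln_primitive n e <= 0.
Proof.
intros He; unfold pow_ln_primitive.
assert (Hl : ln e <= 0) by (rewrite <- ln_1; apply ln_le; lra).
assert (Hn : 1 <= INR (S n)) by (rewrite S_INR; pose proof (pos_INR n); lra).
assert (Hi : 0 < / INR (S n) <= 1).
{ split; [apply Rinv_0_lt_compat; lra|].
  rewrite <- Rinv_1; apply Rinv_le_contravar; lra. }
assert (Hp : 0 <= e ^ n <= 1).
{ split; [apply pow_le; lra|].
  rewrite <- (pow1 n); apply pow_incr; lra. }
replace (ln e / INR (S n) - 1 / INR (S n) ^ 2)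
  with (ln e * / INR (S n) - / INR (S n) * / INR (S n)) by (field; lra).
set (i := / INR (S n)) in *.
change (e ^ S n) with (e * e ^ n).
set (p := e ^ n) in *.
assert (Hq : 0 <= i - ln e <= 1 - ln e) by lra.
assert (Hip : 0 <= i * p <= 1) by nra.
assert (Hz : 0 <= (i * p) * (i - ln e) <= 1 - ln e) by nra.
replace (e * p * (ln e * i - i * i)) with (- (e * (i * p * (i - ln e)))) by ring.
nra.
Qed.

Lemma is_RInt_sine_sum_ln (t e : R) (N : nat) :
  0 < e <= 1 ->
  is_RInt (fun x => sum_n (fun n => sin (INR (S n) * t) * x ^ n) N * ln x) e 1
    (- sum_n (fun n => sin (INR (S n) * t) / INR (S n) ^ 2) N
     - sum_n (fun n => sin (INR (S n) * t) * pow_ln_primitive n e) N).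
Proof.
intros He.
assert (Hterm : forall n, is_RInt
  (fun x => sin (INR (S n) * t) * (x ^ n * ln x)) e 1
  (sin (INR (S n) * t) * (- (1 / INR (S n) ^ 2) - pow_ln_primitive n e))).
{ intros n; apply (is_RInt_scal (V := R_NormedModule)).
  apply is_RInt_pow_ln, He. }
induction N as [|N IH].
- rewrite !sum_O.
  apply is_RInt_ext with (fun x => sin (INR 1 * t) * (x ^ 0 * ln x)).
  { intros x _; rewrite sum_O; symmetry; apply Rmult_assoc. }
  replace (- _ - _) with
    (sin (INR 1 * t) * (- (1 / INR 1 ^ 2) - pow_ln_primitive 0 e))
    by (simpl INR; field).
  apply Hterm.
- rewrite !sum_Sn; change (@plus _ ?u ?v) with (u + v).
  apply is_RInt_ext with
    (fun x => sum_n (fun n => sin (INR (S n) * t) * x ^ n) N * ln x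
              + sin (INR (S (S N)) * t) * (x ^ S N * ln x)).
  { intros x _; rewrite sum_Sn; change (@plus _ ?u ?v) with (u + v).
    symmetry.
    rewrite Rmult_plus_distr_r, Rmult_assoc; reflexivity. }
  replace (- _ - _) with
    ((- sum_n (fun n => sin (INR (S n) * t) / INR (S n) ^ 2) N
      - sum_n (fun n => sin (INR (S n) * t) * pow_ln_primitive n e) N)
     + sin (INR (S (S N)) * t)
       * (- (1 / INR (S (S N)) ^ 2) - pow_ln_primitive (S N) e))
    by (field; apply not_0_INR; lia).
  apply (is_RInt_plus (V := R_NormedModule) _ _ _ _ _ _ IH (Hterm (S N))).
Qed.

Lemma boundary_terms_bound (t e : R) (N : nat) :
  0 < e <= 1 ->
  Rabs (sum_n (fun n => sin (INR (S n) * t) * pow_ln_primitive n e) N)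
  <= INR (S N) * (e * (1 - ln e)).
Proof.
intros He.
assert (Hterm : forall n,
  Rabs (sin (INR (S n) * t) * pow_ln_primitive n e) <= e * (1 - ln e)).
{ intros n; pose proof (pow_ln_primitive_bound n e He) as Hb.
  rewrite Rabs_mult, (Rabs_left1 (pow_ln_primitive n e)) by lra.
  assert (Rabs (sin (INR (S n) * t)) <= 1)
    by (apply Rabs_le; pose proof (SIN_bound (INR (S n) * t)); lra).
  pose proof (Rabs_pos (sin (INR (S n) * t))).
  nra. }
induction N as [|N IH].
- rewrite sum_O.
  replace (INR 1 * (e * (1 - ln e))) with (e * (1 - ln e)) by (simpl; ring).
  apply Hterm.
- rewrite sum_Sn; change (plus ?u ?v) with (u + v).
  replace (INR (S (S N)) * (e * (1 - ln e)))
    with (INR (S N) * (e * (1 - ln e)) + e * (1 - ln e))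
    by (rewrite (S_INR (S N)); ring).
  eapply Rle_trans; [apply Rabs_triang|].
  apply Rplus_le_compat; [exact IH | apply Hterm].
Qed.

(** * The integral over [e, 1] *)

Lemma ex_RInt_ln_quadratic (t e : R) :
  0 < sin t -> 0 < e <= 1 ->
  ex_RInt (fun x => ln x / (x ^ 2 - 2 * cos t * x + 1)) e 1.
Proof.
intros Hs He.
apply (ex_RInt_continuous (V := R_CompleteNormedModule)).
intros x Hx; rewrite Rmin_left, Rmax_right in Hx by lra.
apply (ex_derive_continuous
  (fun x => ln x / (x ^ 2 - 2 * cos t * x + 1))).
pose proof (quadratic_ge_sin_sq t x).
assert (0 < sin t ^ 2) by (apply pow_lt; exact Hs).
auto_derive; repeat split; simpl in *; lra.
Qed.

(** The first error term comes from the remainder of the expansion and does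
    not involve e; the second one comes from the primitives evaluated at e. *)
Lemma integral_error (t e I : R) (N : nat) :
  0 < sin t -> 0 < e <= 1 ->
  is_RInt (fun x => ln x / (x ^ 2 - 2 * cos t * x + 1)) e 1 I ->
  Rabs (sin t * I + sum_n (fun n => sin (INR (S n) * t) / INR (S n) ^ 2) N)
  <= 2 / sin t ^ 2 * (1 / INR (S (S N)) ^ 2) + INR (S N) * (e * (1 - ln e)).
Proof.
intros Hs He HI.
assert (Hc : 0 < 2 / sin t ^ 2)
  by (apply Rdiv_lt_0_compat; [lra | apply pow_lt; exact Hs]).
pose proof (is_RInt_minus (V := R_NormedModule) _ _ _ _ _ _
  (is_RInt_scal (V := R_NormedModule) _ _ _ (sin t) _ HI)
  (is_RInt_sine_sum_ln t e N He)) as Hrem.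
pose proof (is_RInt_scal (V := R_NormedModule) _ _ _ (- (2 / sin t ^ 2)) _
  (is_RInt_pow_ln (S N) e He)) as Hdom.
assert (Hle := fun H => norm_RInt_le _ _ e 1 _ _ (proj2 He) H Hrem Hdom).
pose proof (boundary_terms_bound t e N He) as HB.
pose proof (pow_ln_primitive_bound (S N) e He) as HA.
set (Sg := sum_n (fun n => sin (INR (S n) * t) / INR (S n) ^ 2) N) in *.
set (B := sum_n (fun n => sin (INR (S n) * t) * pow_ln_primitive n e) N) in *.
assert (Hle' : Rabs (sin t * I - (- Sg - B))
  <= - (2 / sin t ^ 2)
     * (- (1 / INR (S (S N)) ^ 2) - pow_ln_primitive (S N) e)).
{ apply Hle; intros x Hx.
  change (Rabs (sin t * (ln x / (x ^ 2 - 2 * cos t * x + 1))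
    - sum_n (fun n => sin (INR (S n) * t) * x ^ n) N * ln x)
    <= - (2 / sin t ^ 2) * (x ^ S N * ln x)).
  assert (Hl : ln x <= 0) by (rewrite <- ln_1; apply ln_le; lra).
  pose proof (sine_remainder_bound t x N Hs ltac:(lra)) as Hr.
  replace (sin t * (ln x / (x ^ 2 - 2 * cos t * x + 1))
    - sum_n (fun n => sin (INR (S n) * t) * x ^ n) N * ln x)
    with ((sin t / (x ^ 2 - 2 * cos t * x + 1)
      - sum_n (fun n => sin (INR (S n) * t) * x ^ n) N) * ln x)
    by (unfold Rdiv; ring).
  rewrite Rabs_mult, (Rabs_left1 (ln x)) by exact Hl.
  apply Rmult_le_compat_r with (r := - ln x) in Hr; [|lra].
  lra. }
replace (sin t * I + Sg) with ((sin t * I - (- Sg - B)) + - B) by ring.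
eapply Rle_trans; [apply Rabs_triang|].
rewrite Rabs_Ropp.
nra.
Qed.

(** * Passage to the limit *)

(** With y = 1/e this is the limit of (1 + ln y) / y at infinity. *)
Lemma filterlim_mul_ln_0 :
  filterlim (fun e => e * (1 - ln e)) (at_right 0) (locally 0).
Proof.
apply filterlim_ext_loc with
  (fun e => (fun y => / y + ln y / y) (/ e)).
{ exists (mkposreal 1 Rlt_0_1); intros e _ He.
  rewrite ln_Rinv by exact He; field; lra. }
apply (filterlim_comp _ _ _ Rinv (fun y => / y + ln y / y) _
  (Rbar_locally p_infty)).
{ exact filterlim_Rinv_0_right. }
change (is_lim (fun y => / y + ln y / y) p_infty 0).
replace (Finite 0) with (Finite (0 + 0)) by (f_equal; ring).
apply is_lim_plus'; [|exact is_lim_div_ln_p].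
apply (is_lim_inv (fun y => y) p_infty p_infty); [apply is_lim_id | discriminate].
Qed.

Lemma is_lim_seq_remainder (c : R) :
  is_lim_seq (fun N => c * (1 / INR (S (S N)) ^ 2)) 0.
Proof.
assert (Hinv : is_lim_seq (fun N => / INR (S (S N))) 0).
{ apply (is_lim_seq_incr_1 (fun n => / INR (S n))).
  apply (is_lim_seq_incr_1 (fun n => / INR n)).
  apply (is_lim_seq_inv _ p_infty); [apply is_lim_seq_INR | discriminate]. }
apply is_lim_seq_ext with (fun N => c * (/ INR (S (S N)) * / INR (S (S N)))).
{ intros N; field; apply not_0_INR; lia. }
replace (Finite 0) with (Finite (c * (0 * 0))) by (f_equal; ring).
apply (is_lim_seq_scal_l _ c (Finite (0 * 0))).
apply is_lim_seq_mult'; exact Hinv.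
Qed.

Theorem mainTheorem2 (a t : R) (ha : a ^ 2 < 1) (ht : 0 < t < PI)
    (hat : a = cos t) :
  is_RInt_gen (fun x : R => ln x / (x ^ 2 - 2 * a * x + 1))
    (at_right 0) (at_point 1)
    (- (1 / sin t) *
       Series (fun n : nat => sin (INR (S n) * t) / INR (S n) ^ 2)) /\
  - (1 / sin t) *
     Series (fun n : nat => sin (INR (S n) * t) / INR (S n) ^ 2)
  = - (Cl2 t / sin t).
Proof.
assert (Hs : 0 < sin t) by (apply sin_gt_0; lra).
split; [|unfold Cl2; field; lra].
subst a.
pose proof (Series_correct _ (ex_series_Cl2 t)) as HS.
set (L := Series _) in *.
intros P [eps HP].
assert (Hd : 0 < sin t * eps / 3)
  by (pose proof (cond_pos eps); apply Rdiv_lt_0_compat; [nra | lra]).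
set (d := mkposreal _ Hd).
(* N makes the tail of the series and the remainder of the expansion small. *)
pose proof (HS _ (locally_ball L d)) as HN1.
pose proof (is_lim_seq_remainder (2 / sin t ^ 2) _ (locally_ball 0 d)) as HN2.
destruct HN1 as [N1 HN1], HN2 as [N2 HN2].
set (N := Nat.max N1 N2).
specialize (HN1 N (Nat.le_max_l _ _)); specialize (HN2 N (Nat.le_max_r _ _)).
change (Rabs (sum_n (fun n => sin (INR (S n) * t) / INR (S n) ^ 2) N - L)
  < sin t * eps / 3) in HN1.
change (Rabs (2 / sin t ^ 2 * (1 / INR (S (S N)) ^ 2) - 0)
  < sin t * eps / 3) in HN2.
rewrite Rminus_0_r in HN2; apply Rabs_def2 in HN2.
assert (HNpos : 0 < INR (S N)) by (apply lt_0_INR; lia).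
assert (Hd' : 0 < sin t * eps / 3 / INR (S N))
  by (apply Rdiv_lt_0_compat; assumption).
apply Filter_prod with
  (fun e => (0 < e <= 1) /\ e * (1 - ln e) < sin t * eps / 3 / INR (S N))
  (fun b => b = 1).
- apply filter_and.
  + exists (mkposreal 1 Rlt_0_1); intros e Hb He.
    change (Rabs (e - 0) < 1) in Hb; apply Rabs_def2 in Hb; lra.
  + generalize (filterlim_mul_ln_0 _ (locally_ball 0 (mkposreal _ Hd'))).
    unfold filtermap; apply filter_imp; intros e Hb.
    change (Rabs (e * (1 - ln e) - 0) < sin t * eps / 3 / INR (S N)) in Hb.
    apply Rabs_def2 in Hb; lra.
- reflexivity.
- intros e b [He Hsmall] ->.
  destruct (ex_RInt_ln_quadratic t e Hs He) as [I HI].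
  exists I; split; [exact HI|].
  apply HP.
  change (Rabs (I - - (1 / sin t) * L) < eps).
  pose proof (integral_error t e I N Hs He HI) as Herr.
  set (Sg := sum_n _ N) in *.
  apply Rmult_lt_compat_l with (r := INR (S N)) in Hsmall; [|exact HNpos].
  replace (INR (S N) * (sin t * eps / 3 / INR (S N)))
    with (sin t * eps / 3) in Hsmall by (field; lra).
  apply Rmult_lt_reg_l with (sin t); [exact Hs|].
  rewrite <- (Rabs_pos_eq (sin t)) at 1 by lra.
  rewrite <- Rabs_mult.
  replace (sin t * (I - - (1 / sin t) * L))
    with ((sin t * I + Sg) - (Sg - L)) by (field; lra).
  eapply Rle_lt_trans; [apply Rabs_triang|].
  rewrite Rabs_Ropp.
  lra.
Qed.
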